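(* Let $K$ be a finite field with $q$ elements, let $G$ be a graph without isolated vertices and let $X$ be the projective toric subset parameterized by $G$. Let $\{v_1,\dots,v_r\}$ be an independent set of ($r$ distinct) vertices of $G$. Assume that there is an edge in $G-\{v_1,\dots,v_r\}$. Then $$\operatorname{reg} K[E_G]/I(X) \geq r(q-2).$$
   Context: Graphs are finite, undirected and without loops; multiple edges are allowed. $V_G$ and $E_G$ denote the vertex set and edge set of $G$. A set of vertices is independent if no edge of $G$ joins two of its elements. $G-\{v_1,\dots,v_r\}$ is the graph obtained by deleting the vertices $v_1,\dots,v_r$ and all edges incident to them. For a graph $G$ with $s=|E_G|\geq 1$ edges, fix an identification of $E_G$ with the variables $t_1,\dots,t_s$ of the standard graded polynomial ring $K[t_1,\dots,t_s]$, which is then denoted $K[E_G]$. For $\mathbf{x}=(x_v)_{v\in V_G}\in (K^* )^{V_G}$ and an edge $t_i=\{v,w\}$ put $\mathbf{x}^{t_i}=x_vx_w$. The projective toric subset parameterized by $G$ is $$X=\{(\mathbf{x}^{t_1},\dots,\mathbf{x}^{t_s})\in \mathbb{P}^{s-1}(K) \mid \mathbf{x}\in (K^* )^{V_G}\},$$ and $I(X)\subset K[E_G]$ is its vanishing ideal, i.e. the ideal generated by all homogeneous polynomials vanishing on $X$. The Castelnuovo--Mumford regularity of a finitely generated graded module $M$ over $S=K[E_G]$, with minimal graded free resolution $0\to F_c\to\cdots\to F_0\to M\to 0$, $F_i\cong\bigoplus_{j} S(-j)^{b_{ij}}$, is $\operatorname{reg} M=\max\{j-i \mid b_{ij}\neq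 0\}$. *)

(* Defs.v *)
From HB Require Import structures.
From mathcomp Require Import all_boot all_order all_algebra.
From mathcomp Require Import generic_quotient ring_quotient boolp.
From mathcomp Require Import ssrcomplements freeg mpoly.

Set Implicit Arguments.
Unset Strict Implicit.
Unset Printing Implicit Defensive.

Import GRing.Theory.
Local Open Scope ring_scope.
Local Open Scope quotient_scope.

(* Loops are excluded by [#|ends e| = 2]; parallel edges are allowed since    *)
(* [ends] need not be injective.                                              *)
Record multigraph := Multigraph {
  vertex : finType;
  edge : finType;
  ends : edge -> {set vertex};
  card_ends : forall e, #|ends e| = 2
}.

Definition no_isolated_vertices (G : multigraph) : Prop :=
  forall v : vertex G, exists e : edge G, v \in ends e.

Definition independent (G : multigraph) (A : {set vertex G}) : Prop :=
  forall v w, v \in A -> w \in A -> forall e : edge G, ends e <> [set v; w].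

Section DeleteVertices.
Variables (G : multigraph) (A : {set vertex G}).

Let remaining_vertex := {v : vertex G | v \notin A}.
Let remaining_edge := {e : edge G | [disjoint ends e & A]}.
Let remaining_ends (e : remaining_edge) : {set remaining_vertex} :=
  [set v | val v \in ends (val e)].

Let card_remaining_ends e : #|remaining_ends e| = 2.
Proof.
rewrite -(card_ends (val e)) -(card_imset _ val_inj); congr #|pred_of_set _|.
apply/setP=> v; apply/imsetP/idP=> [[w]|ve]; first by rewrite inE => we ->.
have vA : v \notin A by move: (valP e) => /disjointFr /(_ ve) ->.
by exists (exist _ v vA); rewrite ?inE.
Qed.

Definition delete_vertices : multigraph :=
  Multigraph card_remaining_ends.

End DeleteVertices.

Section GeneratedIdeal.
Variables (R : comNzRingType) (P : R -> Prop).

Definition generated_ideal : {pred R} := fun f =>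
  `[< exists (n : nat) (a g : 'I_n -> R),
        (forall k, P (g k)) /\ f = \sum_(k < n) a k * g k >].

Lemma generated_idealM a f : f \in generated_ideal -> a * f \in generated_ideal.
Proof.
move=> /asboolP[n [b [g [Pg ->]]]]; apply/asboolP.
exists n, (fun k => a * b k), g; split=> //.
by rewrite mulr_sumr; apply: eq_bigr => k _; rewrite mulrA.
Qed.

Lemma generated_ideal_zmod_closed : zmod_closed generated_ideal.
Proof.
split=> [|f f' If].
  apply/asboolP; exists 0%N, (fun=> 0), (fun=> 0).
  by split=> [[]//|]; rewrite big_ord0.
rewrite -mulN1r => /(generated_idealM (-1)) /asboolP[n' [a' [g' [Pg' ->]]]].
case/asboolP: If => n [a [g [Pg ->]]]; apply/asboolP.
pose sel (u : 'I_n -> R) (u' : 'I_n' -> R) (k : 'I_(n + n')) :=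
  match split k with inl i => u i | inr j => u' j end.
have sell u u' i : sel u u' (lshift n' i) = u i.
  by rewrite /sel -[lshift _ _]/(unsplit (inl i)) unsplitK.
have selr u u' j : sel u u' (rshift n j) = u' j.
  by rewrite /sel -[rshift _ _]/(unsplit (inr j)) unsplitK.
exists (n + n')%N, (sel a a'), (sel g g'); split=> [k|].
  by rewrite /sel; case: split.
rewrite big_split_ord /=; congr (_ + _); apply: eq_bigr => k _.
  by rewrite !sell.
by rewrite !selr.
Qed.

HB.instance Definition _ :=
  GRing.isZmodClosed.Build R generated_ideal generated_ideal_zmod_closed.

Definition quot_module := Quotient.quot generated_ideal.
HB.instance Definition _ := GRing.Zmodule.on quot_module.

Definition quot_proj (f : R) : quot_module := \pi_quot_module f.

Lemma quot_projP f g : quot_proj f = quot_proj g <-> f - g \in generated_ideal.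
Proof. by rewrite Quotient.idealrBE; split=> [/eqP|/eqP]. Qed.

Lemma quot_projK (x : quot_module) : quot_proj (repr x) = x.
Proof. exact: reprK. Qed.

Lemma quot_proj_zmod_morphism : zmod_morphism quot_proj.
Proof. by move=> f g; rewrite /quot_proj raddfB. Qed.

HB.instance Definition _ :=
  GRing.isZmodMorphism.Build R quot_module quot_proj quot_proj_zmod_morphism.

Definition quot_scale (a : R) (x : quot_module) : quot_module :=
  quot_proj (a * repr x).

Lemma quot_scaleE a f : quot_scale a (quot_proj f) = quot_proj (a * f).
Proof.
apply/quot_projP; rewrite -mulrBr generated_idealM //.
by apply/quot_projP; rewrite quot_projK.
Qed.

Lemma quot_scaleA a b x : quot_scale a (quot_scale b x) = quot_scale (a * b) x.
Proof. by rewrite -[x]quot_projK !quot_scaleE mulrA. Qed.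

Lemma quot_scale1 : left_id 1 quot_scale.
Proof. by move=> x; rewrite -[x]quot_projK quot_scaleE mul1r. Qed.

Lemma quot_scaleDr : right_distributive quot_scale +%R.
Proof.
move=> a x y; rewrite -[x]quot_projK -[y]quot_projK -raddfD !quot_scaleE.
by rewrite mulrDr raddfD.
Qed.

Lemma quot_scaleDl x : {morph quot_scale^~ x : a b / a + b}.
Proof. by move=> a b; rewrite -[x]quot_projK !quot_scaleE mulrDl raddfD. Qed.

HB.instance Definition _ := GRing.Zmodule_isLmodule.Build R quot_module
  quot_scaleA quot_scale1 quot_scaleDr quot_scaleDl.

Lemma quot_projZ a f : quot_proj (a * f) = a *: quot_proj f.
Proof. by rewrite -quot_scaleE. Qed.

End GeneratedIdeal.

Section GradedModules.
Variables (K : fieldType) (s : nat).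
Local Notation S := {mpoly K[s]}.

(* [mpoly] grades by [nat]; the components of negative degree are 0. *)
Definition homog_deg (d : int) (f : S) : Prop :=
  match d with Posz n => f \is n.-homog | Negz _ => f = 0 end.

Record graded_module := GradedModule {
  gm_sort :> lmodType S;
  gm_part : int -> gm_sort -> Prop;
  gm_part0 : forall d, gm_part d 0;
  gm_partB : forall d x y, gm_part d x -> gm_part d y -> gm_part d (x - y);
  gm_partZ : forall (n : nat) d (a : S) x,
    a \is n.-homog -> gm_part d x -> gm_part (n%:Z + d) (a *: x);
  gm_span : forall x, exists (D : seq int) (y : int -> gm_sort),
    [/\ uniq D, forall d, gm_part d (y d) & x = \sum_(d <- D) y d];
  gm_direct : forall (D : seq int) (y : int -> gm_sort),
    uniq D -> (forall d, gm_part d (y d)) -> \sum_(d <- D) y d = 0 ->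
    forall d, d \in D -> y d = 0
}.

(* A minimal graded free resolution ... -> F_1 -> F_0 -> M -> 0, given in     *)
(* homogeneous bases: F_i is the direct sum of S(- mgr_shift i k) for         *)
(* k < mgr_rank i, its elements are row vectors, and the matrices act on the  *)
(* right.  Entries of a degree-0 map S(-a) -> S(-b) have degree a - b;        *)
(* minimality says that F_(i+1) maps into (t_1, ..., t_s) F_i.                *)
Record min_graded_resolution (M : graded_module) := MinGradedResolution {
  mgr_length : nat;
  mgr_rank : nat -> nat;
  mgr_shift : forall i, 'I_(mgr_rank i) -> int;
  mgr_aug : {linear 'rV[S]_(mgr_rank 0) -> M};
  mgr_diff : forall i, 'M[S]_(mgr_rank i.+1, mgr_rank i);
  mgr_finite : forall i, (mgr_length < i)%N -> mgr_rank i = 0%N;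
  mgr_aug_homog : forall k, gm_part (mgr_shift k) (mgr_aug (delta_mx 0 k));
  mgr_diff_homog : forall i (k : 'I_(mgr_rank i.+1)) (l : 'I_(mgr_rank i)),
    homog_deg (mgr_shift k - mgr_shift l) (mgr_diff i k l);
  mgr_surj : forall x : M, exists u, mgr_aug u = x;
  mgr_exact0 : forall u, mgr_aug u = 0 <-> exists w, u = w *m mgr_diff 0;
  mgr_exact : forall i (u : 'rV_(mgr_rank i.+1)),
    u *m mgr_diff i = 0 <-> exists w, u = w *m mgr_diff i.+1;
  mgr_minimal : forall i k l, (mgr_diff i k l)@_0%MM = 0
}.

Definition betti (M : graded_module) (F : min_graded_resolution M)
    (i : nat) (j : int) : nat :=
  #|[set k : 'I_(mgr_rank F i) | mgr_shift k == j]|.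

(* [rho] is reg M.  The minimal graded free resolution of M is unique up to   *)
(* isomorphism, so at most one [rho] qualifies; a finitely generated M <> 0   *)
(* has one by Hilbert's syzygy theorem.                                       *)
Definition is_regularity (M : graded_module) (rho : int) : Prop :=
  exists F : min_graded_resolution M,
    (exists i j, betti F i j <> 0%N /\ rho = j - i%:Z) /\
    (forall i j, betti F i j <> 0%N -> j - i%:Z <= rho).

Section GradedQuotient.
Variables (P : S -> Prop) (homP : forall g, P g -> exists d, g \is d.-homog).
Local Notation I := (generated_ideal P).
Local Notation Q := (quot_module P).

Definition quot_part (d : int) (x : Q) : Prop :=
  exists2 f : S, homog_deg d f & x = quot_proj P f.

Lemma homog_deg0 d : homog_deg d 0.
Proof. by case: d => // n; apply: rpred0. Qed.

Lemma homog_degB d f g :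
  homog_deg d f -> homog_deg d g -> homog_deg d (f - g).
Proof. by case: d => n /= => [|-> ->]; [exact: rpredB | rewrite subrr]. Qed.

Lemma homog_degM (n : nat) d f g :
  f \is n.-homog -> homog_deg d g -> homog_deg (n%:Z + d) (f * g).
Proof.
case: d => m hf /= => [hg | ->]; last by rewrite mulr0; exact: homog_deg0.
exact: dhomogM.
Qed.

Lemma pihomog_generated d f : f \in I -> pihomog mdeg d f \in I.
Proof.
move=> /asboolP[n [a [g [Pg ->]]]]; rewrite raddf_sum rpred_sum // => k _ /=.
have [e ge] := homP (Pg k).
have Ig b : b * g k \in I.
  apply/generated_idealM/asboolP; exists 1%N, (fun=> 1), (fun=> g k).
  by split=> //; rewrite big_ord1 mul1r.
rewrite [a k](pihomog_partitionE (leqnn (mmeasure mdeg (a k)))).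
rewrite mulr_suml raddf_sum rpred_sum // => i _ /=.
have h := dhomogM (pihomogP mdeg i (a k)) ge.
have [<-|ne] := eqVneq (i + e)%N d; first by rewrite (pihomog_dE h).
by rewrite (pihomog_ne0 ne h) rpred0.
Qed.

Lemma quot_part0 d : quot_part d 0.
Proof. by exists 0; rewrite ?raddf0 //; exact: homog_deg0. Qed.

Lemma quot_partB d x y : quot_part d x -> quot_part d y -> quot_part d (x - y).
Proof.
by move=> [f hf ->] [g hg ->]; exists (f - g); [exact: homog_degB | rewrite raddfB].
Qed.

Lemma quot_partZ (n : nat) d (a : S) x :
  a \is n.-homog -> quot_part d x -> quot_part (n%:Z + d) (a *: x).
Proof.
move=> ha [f hf ->]; exists (a * f); first exact: homog_degM.
by rewrite quot_projZ.
Qed.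

Lemma quot_span (x : Q) : exists (D : seq int) (y : int -> Q),
  [/\ uniq D, forall d, quot_part d (y d) & x = \sum_(d <- D) y d].
Proof.
pose f := repr x; pose n := mmeasure mdeg f.
exists [seq Posz i | i <- iota 0 n].
exists (fun d => if d is Posz i then quot_proj P (pihomog mdeg i f) else 0).
split=> [|[i|i]|]; first by rewrite map_inj_uniq ?iota_uniq // => ? ? [].
- by exists (pihomog mdeg i f) => //; exact: pihomogP.
- exact: quot_part0.
rewrite big_map -{1}[x]quot_projK -/f.
rewrite {1}[f](pihomog_partitionE (leqnn n)) raddf_sum.
by rewrite -(subn0 n) -/(index_iota 0 n) big_mkord subn0.
Qed.

Lemma quot_direct (D : seq int) (y : int -> Q) :
  uniq D -> (forall d, quot_part d (y d)) -> \sum_(d <- D) y d = 0 ->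
  forall d, d \in D -> y d = 0.
Proof.
move=> uD hy sum0 d dD.
have hy' e : {f : S | homog_deg e f /\ y e = quot_proj P f}.
  by apply: cid; have [f ? ?] := hy e; exists f.
pose F e := sval (hy' e).
have [hF yF] : (forall e, homog_deg e (F e)) /\ (forall e, y e = quot_proj P (F e)).
  by split=> e; rewrite /F; case: (hy' e) => f [].
case: d dD => [n|n] dD; last first.
  by rewrite yF; have /= -> := hF (Negz n); rewrite raddf0.
rewrite yF -(raddf0 (quot_proj P)); apply/quot_projP; rewrite subr0.
have : \sum_(e <- D) F e \in I.
  rewrite -[X in X \in _]subr0; apply/quot_projP; rewrite raddf0 raddf_sum -[RHS]sum0.
  by apply: eq_bigr => e _; rewrite yF.
move/(pihomog_generated n); rewrite raddf_sum (bigD1_seq (Posz n)) //=.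
rewrite (pihomog_dE (hF (Posz n))) big1 ?addr0 // => -[m|m] ne /=.
  by apply: (pihomog_ne0 _ (hF (Posz m))); apply: contraNneq ne => ->.
by have /= -> := hF (Negz m); rewrite raddf0.
Qed.

Definition quot_graded : graded_module :=
  GradedModule quot_part0 quot_partB quot_partZ quot_span quot_direct.

End GradedQuotient.
End GradedModules.

(* P^(s-1)(K) as the set of lines of K^s. *)
Definition proj_space (K : fieldType) (s : nat) : Type :=
  {U : {vspace 'rV[K]_s} | \dim U == 1%N}.

(* Meant for homogeneous [f]. *)
Definition vanishes_at (K : fieldType) (s : nat) (f : {mpoly K[s]})
    (p : proj_space K s) : Prop :=
  forall y : 'rV[K]_s, y \in sval p -> y != 0 -> f.@[fun i => y 0 i] = 0.

Definition homog_vanishing (K : fieldType) (s : nat)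
    (X : proj_space K s -> Prop) (f : {mpoly K[s]}) : Prop :=
  (exists d, f \is d.-homog) /\ (forall p, X p -> vanishes_at f p).

Definition vanishing_ideal (K : fieldType) (s : nat)
    (X : proj_space K s -> Prop) : {pred {mpoly K[s]}} :=
  generated_ideal (homog_vanishing X).

Lemma homog_vanishing_homog (K : fieldType) (s : nat)
    (X : proj_space K s -> Prop) (f : {mpoly K[s]}) :
  homog_vanishing X f -> exists d, f \is d.-homog.
Proof. by case. Qed.

(* K[t_1, ..., t_s] / I(X) *)
Definition coordinate_ring (K : fieldType) (s : nat)
    (X : proj_space K s -> Prop) : graded_module K s :=
  quot_graded (@homog_vanishing_homog K s X).

(* The i-th variable of K[E_G] is the i-th edge in the enumeration of the     *)
(* edge type.                                                                 *)
Definition toric_point (K : fieldType) (G : multigraph) (x : vertex G -> K) :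
    'rV[K]_#|edge G| :=
  \row_i \prod_(v in ends (enum_val i)) x v.

Definition toric_subset (K : fieldType) (G : multigraph)
    (p : proj_space K #|edge G|) : Prop :=
  exists2 x : vertex G -> K, (forall v, x v != 0) &
    sval p = <[toric_point x]>%VS.
Arguments toric_subset : clear implicits.

(* Main.v *)
From HB Require Import structures.
Require Import Defs.
From mathcomp Require Import all_boot all_order all_algebra.
From mathcomp Require Import boolp mpoly.
From mathcomp Require finfield.
From mathcomp Require Import zify.

Set Implicit Arguments.
Unset Strict Implicit.
Unset Printing Implicit Defensive.

Import Order.TTheory GRing.Theory Num.Theory.
Local Open Scope ring_scope.

(** Let [e] be an edge avoiding the independent set [A], and [I = I(X)].
    The variable [t_e] vanishes nowhere on [X], so it is a nonzerodivisor on
    [M = S/I], and [t_j^(q-1) - t_e^(q-1)] lies in [I] for every [j], so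
    [M/t_e M] vanishes in large degrees.  Hence [reg M] is at least the degree
    of any monomial outside [I + (t_e)].

    For this last bound, let [F] be a resolution of [M].  Killing the variables
    one at a time, beginning with [t_e], a nonzero socle element of degree [d]
    of [M/t_e M = H_0(F/t_e F)] is pushed by the connecting maps to nonzero
    socle elements of [H_k(F/(t_j, j in B)F)] of degree [d + k], for
    [#|B| = k + 1].  When [B] contains all the variables this is a nonzero
    element of [F_(s-1)/(t_1, ..., t_s)F_(s-1)], so [F_(s-1)] has a generator
    of degree [d + s - 1].

    The monomial is the product of the [t_(c v)^(q-2)], where [c v] is an edge
    at [v] and [v] runs through [A].  To see that it is not in [I + (t_e)], sum
    over the units [x] of [K^A] against the weight [prod x_v]: this kills [I], and it
    kills every monomial whose degree at some [v in A] is less than [q - 2].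
    A multiple of [t_e] of degree [#|A|(q-2)] is such a monomial, since an edge
    meets [A] at most once and [e] does not meet it. *)

(** * Ideals generated by sets of variables, and vectors modulo them *)

Section VariableIdeal.
Variables (K : fieldType) (s : nat).
Local Notation S := {mpoly K[s]}.
Implicit Types (B : {set 'I_s}) (f g : S) (j : 'I_s).

(* Membership in the monomial ideal [(t_j, j \in B)]. *)
Definition var_ideal B f : Prop :=
  forall m : 'X_{1..s}, (forall j, j \in B -> m j = 0%N) -> f@_m = 0.

Lemma var_ideal0 B : var_ideal B 0.
Proof. by move=> m _; rewrite mcoeff0. Qed.

Lemma var_idealD B f g : var_ideal B f -> var_ideal B g -> var_ideal B (f + g).
Proof. by move=> hf hg m Bm; rewrite mcoeffD hf ?hg ?addr0. Qed.

Lemma var_idealM B f g : var_ideal B f -> var_ideal B (f * g).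
Proof.
move=> hf m Bm; rewrite mcoeffM big1 // => -[k1 k2] /= /eqP/mnmP mE.
rewrite hf ?mul0r // => j jB; have := mE j.
by rewrite Bm // mnmDE => /esym/eqP; rewrite addn_eq0 => /andP[/eqP].
Qed.

Lemma var_idealS B (B' : {set 'I_s}) f :
  B \subset B' -> var_ideal B f -> var_ideal B' f.
Proof. by move=> /subsetP BB' hf m Bm; apply: hf => j /BB'; exact: Bm. Qed.

Lemma var_ideal_gen B f j : j \in B -> var_ideal B ('X_j * f).
Proof.
move=> jB; apply: var_idealM => m Bm; rewrite mcoeffX.
by case: eqP => // mE; have := Bm j jB; rewrite -mE mnm1E eqxx.
Qed.

(** For [j] outside [B], multiplying a monomial by ['X_j] leaves its exponents at [B] unchanged. *)
Lemma var_ideal_colon B f j : j \notin B -> var_ideal B ('X_j * f) -> var_ideal B f.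
Proof.
move=> jB hf m Bm; rewrite -(mcoeffMX f U_(j)) mulrC; apply: hf => i iB.
by rewrite mnmDE mnm1E Bm //; case: eqP iB jB => // -> ->.
Qed.

Lemma var_ideal_split B f j :
  var_ideal (j |: B) f -> exists g, var_ideal B (f - 'X_j * g).
Proof.
move=> hf.
(* The witness collects the terms of [f] divisible by ['X_j], each divided by it; the other terms
   must involve a variable of [B]. *)
exists (\sum_(m <- msupp f | m j != 0%N) f@_m *: 'X_[m - U_(j)]).
have -> : f - 'X_j * (\sum_(m <- msupp f | m j != 0%N) f@_m *: 'X_[m - U_(j)])
    = \sum_(m <- msupp f | m j == 0%N) f@_m *: 'X_[m].
  rewrite {1}[f]mpolyE (bigID (fun m : 'X_{1..s} => m j == 0%N)) /=.
  rewrite -[RHS]addr0 -addrA; congr (_ + _); apply/eqP; rewrite subr_eq0; apply/eqP.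
  rewrite mulr_sumr; apply: eq_bigr => m mj.
  rewrite -scalerAr -mpolyXD addmC submK //; apply/mnm_lepP => i.
  by rewrite mnm1E; case: eqP => // <-; rewrite lt0n.
move=> m Bm; rewrite raddf_sum /= big1_seq // => n /andP[/eqP nj _].
rewrite mcoeffZ mcoeffX; case: eqP => [nm|]; last by rewrite mulr0.
rewrite nm hf ?mul0r // => i /setU1P[->|/Bm //].
by rewrite -nm.
Qed.

Lemma var_ideal_homog_pos (d : int) f :
  0 < d -> homog_deg d f -> var_ideal setT f.
Proof.
case: d => // d d0 hf m Tm; have -> : m = 0%MM by apply/mnmP=> j; rewrite mnm0E Tm ?inE.
by apply: (dhomog_nemf_coeff hf); rewrite /= mdeg0; case: d d0 {hf}.
Qed.

Definition var_mod B n (u : 'rV[S]_n) : Prop := forall k, var_ideal B (u 0 k).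

Lemma var_mod0 B n : var_mod B (0 : 'rV_n).
Proof. by move=> k; rewrite mxE; exact: var_ideal0. Qed.

Lemma var_modD B n (u v : 'rV_n) : var_mod B u -> var_mod B v -> var_mod B (u + v).
Proof. by move=> hu hv k; rewrite mxE; exact: var_idealD. Qed.

Lemma var_modZ B n a (u : 'rV_n) : var_mod B u -> var_mod B (a *: u).
Proof. by move=> hu k; rewrite mxE mulrC; exact: var_idealM. Qed.

Lemma var_modN B n (u : 'rV_n) : var_mod B u -> var_mod B (- u).
Proof. by rewrite -scaleN1r; exact: var_modZ. Qed.

Lemma var_modB B n (u v : 'rV_n) : var_mod B u -> var_mod B v -> var_mod B (u - v).
Proof. by move=> hu /var_modN; exact: var_modD. Qed.

Lemma var_modM B n p (u : 'rV_n) (D : 'M_(n, p)) : var_mod B u -> var_mod B (u *m D).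
Proof.
move=> hu k; rewrite mxE; apply: (big_ind (var_ideal B)) => [||i _]; first exact: var_ideal0.
  by move=> *; exact: var_idealD.
exact: var_idealM.
Qed.

Lemma var_mod_set0 n (u : 'rV_n) : var_mod set0 u -> u = 0.
Proof.
move=> hu; apply/rowP=> k; rewrite mxE; apply/mpolyP=> m; rewrite mcoeff0.
by apply: hu => j; rewrite inE.
Qed.

Lemma var_modS B (B' : {set 'I_s}) n (u : 'rV_n) :
  B \subset B' -> var_mod B u -> var_mod B' u.
Proof. by move=> BB' hu k; exact: var_idealS (hu k). Qed.

Lemma var_mod_gen B n (u : 'rV_n) j : j \in B -> var_mod B ('X_j *: u).
Proof. by move=> jB k; rewrite mxE; exact: var_ideal_gen. Qed.

Lemma var_mod_colon B n (u : 'rV_n) j :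
  j \notin B -> var_mod B ('X_j *: u) -> var_mod B u.
Proof. by move=> jB hu k; apply: (@var_ideal_colon B _ j) => //; have := hu k; rewrite mxE. Qed.

Lemma var_mod_split B n (u : 'rV_n) j :
  var_mod (j |: B) u -> exists v, var_mod B (u - 'X_j *: v).
Proof.
move=> hu; have /choice[g hg] k := var_ideal_split (hu k).
by exists (\row_k g k) => k; rewrite !mxE.
Qed.

End VariableIdeal.

(** * Homogeneous components in integer degrees *)

Section GradedComponent.
Variables (K : fieldType) (s : nat).
Local Notation S := {mpoly K[s]}.

Definition hcomp (d : int) (f : S) : S :=
  if d is Posz n then pihomog mdeg n f else 0.

Lemma homog_hcomp d f : homog_deg d (hcomp d f).
Proof. by case: d => n //=; exact: pihomogP. Qed.

Lemma hcomp_is_zmod_morphism d : zmod_morphism (hcomp d).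
Proof. by case: d => n f g /=; rewrite ?raddfB ?subrr. Qed.

HB.instance Definition _ d :=
  GRing.isZmodMorphism.Build S S (hcomp d) (hcomp_is_zmod_morphism d).

Lemma mcoeff_hcomp d f m :
  (hcomp d f)@_m = if (mdeg m)%:Z == d then f@_m else 0.
Proof.
case: d => n /=; last by rewrite mcoeff0.
elim/mpolyind: f => [|c m' f _ _ IH]; first by rewrite raddf0 mcoeff0 if_same.
rewrite (linearP (pihomog mdeg n)) /= pihomogX !mcoeffD !mcoeffZ IH mcoeffX.
case: (eqVneq m' m) => [->|ne]; rewrite eqz_nat.
  by case: eqP; rewrite ?mcoeffX ?eqxx // mcoeff0 mulr0 addr0.
rewrite mulr0 !add0r; case: (mdeg m' == n); last by rewrite mcoeff0 mulr0 add0r.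
by rewrite mcoeffX (negbTE ne) mulr0 add0r.
Qed.

Lemma hcompM d c f a : homog_deg c a -> hcomp (d + c) (f * a) = hcomp d f * a.
Proof.
move=> ha; apply/mpolyP=> m; rewrite mcoeff_hcomp !mcoeffM.
have key (k1 k2 : 'X_{1..s}) : m = (k1 + k2)%MM ->
    (hcomp d f)@_k1 * a@_k2 = if (mdeg m)%:Z == d + c then f@_k1 * a@_k2 else 0.
  case: c ha => [c|c] /= ha; last by rewrite ha mcoeff0 !mulr0 if_same.
  move=> ->; have [<-|kc] := eqVneq (mdeg k2) c; last first.
    by rewrite (dhomog_nemf_coeff ha) // !mulr0 if_same.
  by rewrite mcoeff_hcomp mdegD PoszD (inj_eq (addIr _)); case: ifP; rewrite ?mul0r.
by case: ifP => mE; [apply: eq_bigr | apply/esym/big1] => k /eqP/key ->; rewrite mE.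
Qed.

End GradedComponent.

(** * Killing variables in a graded free resolution *)

Section Resolution.
Variables (K : fieldType) (s : nat) (M : graded_module K s).
Variable F : min_graded_resolution M.
Local Notation S := {mpoly K[s]}.
Local Notation Fr i := 'rV[S]_(mgr_rank F i).
Implicit Types (B : {set 'I_s}) (d : int).

Definition res_comp i d (u : Fr i) : Fr i := \row_k hcomp (d - mgr_shift k) (u 0 k).

Lemma res_comp_diff i d (u : Fr i.+1) :
  res_comp d (u *m mgr_diff F i) = res_comp d u *m mgr_diff F i.
Proof.
apply/rowP=> l; rewrite !mxE raddf_sum; apply: eq_bigr => k _ /=.
by rewrite mxE -(hcompM _ _ (mgr_diff_homog k l)) addrA subrK.
Qed.

Lemma res_compX i d (u : Fr i) j :
  res_comp (d + 1) ('X_j *: u) = 'X_j *: res_comp d u.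
Proof.
apply/rowP=> k; rewrite !mxE mulrC addrAC (@hcompM _ _ _ 1) ?(mulrC 'X_j) //=.
by rewrite dhomogX /= mdeg1.
Qed.

Lemma res_compB i d (u v : Fr i) : res_comp d (u - v) = res_comp d u - res_comp d v.
Proof. by apply/rowP=> k; rewrite !mxE raddfB. Qed.

Lemma res_comp_id i d (u : Fr i) : res_comp d (res_comp d u) = res_comp d u.
Proof.
apply/rowP=> k; rewrite !mxE; apply/mpolyP=> m.
by rewrite !mcoeff_hcomp; case: (_ == _).
Qed.

Lemma var_mod_res_comp B i d (u : Fr i) : var_mod B u -> var_mod B (res_comp d u).
Proof. by move=> hu k m Bm; rewrite mxE mcoeff_hcomp hu ?if_same. Qed.

Lemma diff_comp i (u : Fr i.+2) : u *m mgr_diff F i.+1 *m mgr_diff F i = 0.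
Proof. by apply/mgr_exact; exists u. Qed.

(* F/(t_j, j \in B)F is exact in homological degrees > k. *)
Definition exact_above B k : Prop := forall i, (k <= i)%N ->
  forall u : Fr i.+1, var_mod B (u *m mgr_diff F i) ->
  exists w : Fr i.+2, var_mod B (u - w *m mgr_diff F i.+1).

(* A nonzero class of degree d in H_k(F/(t_j, j \in B)F) killed by every      *)
(* variable, except that u is not required to be a cycle.                     *)
Definition socle_class B k d : Prop := exists u : Fr k,
  [/\ res_comp d u = u,
      forall j, exists w : Fr k.+1, var_mod B ('X_j *: u - w *m mgr_diff F k)
    & ~ exists w : Fr k.+1, var_mod B (u - w *m mgr_diff F k)].

(** In the long exact sequence for multiplication by ['X_j] on F/BF, each homology group of the new
    quotient in degree > k+1 sits between two vanishing groups of F/BF. *)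
Lemma exact_above_step B k j : j \notin B ->
  exact_above B k -> exact_above (j |: B) k.+1.
Proof.
move=> jB exB [//|i] ki u /var_mod_split[v uv].
have [w vw] : exists w : Fr i.+2, var_mod B (v - w *m mgr_diff F i.+1).
  apply: exB => //; apply: (@var_mod_colon _ _ _ _ _ j) => //.
  have := var_modM (mgr_diff F i) uv.
  by rewrite mulmxBl diff_comp sub0r -scalemxAl => /var_modN; rewrite opprK.
have [|w' uw'] := exB i.+1 (leqW ki) (u - 'X_j *: w).
  rewrite mulmxBl -scalemxAl.
  have := var_modD uv (var_modZ 'X_j vw).
  by rewrite scalerBr addrA subrK.
exists w'; have := var_modD (var_modS (subsetUr [set j] B) uw')
  (var_mod_gen w (setU11 j B)).
by rewrite addrAC subrK.
Qed.

(** Since ['X_j] kills the class of [u], that class is the image of some [w] under the connecting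
    map H_(k+1) -> H_k. Exactness above [k] makes this map injective, so [w] is again killed by all
    variables. *)
Lemma socle_class_step B k j d : j \notin B ->
  exact_above B k -> socle_class B k d -> socle_class (j |: B) k.+1 (d + 1).
Proof.
move=> jB exB [u [ud uX uN]]; have [w0 w0P] := uX j.
pose w := res_comp (d + 1) w0.
have wP : var_mod B ('X_j *: u - w *m mgr_diff F k).
  have := var_mod_res_comp (d + 1) w0P.
  by rewrite res_compB res_compX ud res_comp_diff.
exists w; split=> [|i|[v vP]].
- exact: res_comp_id.
- have [v vP] := uX i.
  (* This difference is a cycle modulo [B]: both of its terms map to ['X_i * 'X_j *: u]. *)
  have [|v' v'P] := exB k (leqnn k) ('X_i *: w - 'X_j *: v).
    have := var_modB (var_modZ 'X_j vP) (var_modZ 'X_i wP).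
    rewrite mulmxBl -!scalemxAl !scalerBr !scalerA (mulrC 'X_i 'X_j).
    by rewrite opprB addrC addrA subrK.
  exists v'; have := var_modD (var_modS (subsetUr [set j] B) v'P)
    (var_mod_gen v (setU11 j B)).
  by rewrite addrAC subrK.
apply: uN; have [v' v'P] := var_mod_split vP.
exists v'; apply: (@var_mod_colon _ _ _ _ _ j) => //.
have := var_modD wP (var_modM (mgr_diff F k) v'P).
by rewrite !mulmxBl diff_comp subr0 -scalemxAl scalerBr addrA subrK.
Qed.

(** If [rho < d], every coordinate of [u] is homogeneous of positive degree, so [u] vanishes modulo
    the variables, against its being nonzero there. *)
Lemma socle_class_full d k rho :
  (forall l : 'I_(mgr_rank F k), mgr_shift l - k%:Z <= rho) ->
  socle_class setT k (d + k%:Z) -> d <= rho.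
Proof.
move=> shP [u [ud _ uN]]; rewrite leNgt; apply/negP => rd.
apply: uN; exists 0; rewrite mul0mx subr0 => l.
apply: (@var_ideal_homog_pos _ _ (d + k%:Z - mgr_shift l)).
  by rewrite subr_gt0 -ltrBlDr; exact: le_lt_trans (shP l) rd.
by rewrite -ud mxE; exact: homog_hcomp.
Qed.

Lemma socle_class_le B d rho :
  (forall k (l : 'I_(mgr_rank F k)), mgr_shift l - k%:Z <= rho) ->
  forall k, #|B| = k.+1 -> exact_above B k -> socle_class B k (d + k%:Z) -> d <= rho.
Proof.
(* Induction on the number of variables not yet killed. *)
move=> shP k; move En: (#|~: B|) => n.
elim: n k B En => [|n IHn] k B En Bk exB socB.
  move/eqP: En; rewrite cards_eq0 => /eqP En.
  by apply: (socle_class_full (shP k)); rewrite -setC0 -En setCK.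
have [j] : exists j, j \in ~: B by apply/set0Pn; rewrite -cards_eq0 En.
rewrite inE => jB; apply: (IHn k.+1 (j |: B)).
- by have := cardsC B; have := cardsC (j |: B); rewrite cardsU1 jB Bk En; lia.
- by rewrite cardsU1 jB Bk.
- exact: exact_above_step.
have -> : d + k.+1%:Z = d + k%:Z + 1 by lia.
exact: socle_class_step.
Qed.

Lemma aug_diff (w : Fr 1) : mgr_aug F (w *m mgr_diff F 0) = 0.
Proof. by apply/mgr_exact0; exists w. Qed.

(** This is the vanishing of Tor_i(S/(t_e), M) for i > 0, as t_e is regular on M. *)
Lemma exact_above_regular (e : 'I_s) :
  (forall x : M, 'X_e *: x = 0 -> x = 0) -> exact_above [set e] 0.
Proof.
move=> reg i _ u; rewrite -[[set e]]setU0 => /var_mod_split[v /var_mod_set0/eqP].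
rewrite subr_eq0 => /eqP uv.
have [w vw] : exists w, v = w *m mgr_diff F i.
  case: i => [|i] in u v uv *; last first.
    apply/mgr_exact/var_mod_set0; apply: (@var_mod_colon _ _ _ _ _ e); rewrite ?inE //.
    by rewrite scalemxAl -uv diff_comp; exact: var_mod0.
  by apply/mgr_exact0/reg; rewrite -linearZ -uv aug_diff.
have [w' uw'] : exists w', u - 'X_e *: w = w' *m mgr_diff F i.+1.
  by apply/mgr_exact; rewrite mulmxBl -scalemxAl -vw uv subrr.
by exists w'; rewrite -uw' subKr; apply: var_mod_gen; rewrite setU0 inE.
Qed.

Lemma gm_part_sum d (I : Type) (r : seq I) (P : pred I) (x : I -> M) :
  (forall k, P k -> gm_part d (x k)) -> gm_part d (\sum_(k <- r | P k) x k).
Proof.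
move=> hx; apply: (big_ind (fun y : M => gm_part d y)) => //; first exact: gm_part0.
move=> y z hy hz; rewrite -[z]opprK; apply: gm_partB => //.
by rewrite -sub0r; apply: gm_partB => //; exact: gm_part0.
Qed.

Lemma gm_part_aug d (u : Fr 0) : gm_part d (mgr_aug F (res_comp d u)).
Proof.
rewrite [res_comp d u]row_sum_delta raddf_sum; apply: gm_part_sum => k _ /=.
rewrite linearZ mxE /=.
have := homog_hcomp (d - mgr_shift k) (u 0 k); have := mgr_aug_homog k.
case En: (d - mgr_shift k) => [n|n] hk /= hu; last by rewrite scale0r; exact: gm_part0.
by rewrite -[d](subrK (mgr_shift k)) En; exact: gm_partZ.
Qed.

Lemma aug_res_comp d (u : Fr 0) :
  gm_part d (mgr_aug F u) -> mgr_aug F (res_comp d u) = mgr_aug F u.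
Proof.
move=> ud.
(* [D] contains [d] and every degree in which [u] can have a nonzero component. *)
pose D := undup (d :: [seq n%:Z + mgr_shift k | k <- enum 'I_(mgr_rank F 0),
                                         n <- iota 0 (msize (u 0 k))]).
have dD : d \in D by rewrite mem_undup mem_head.
have uD : uniq D := undup_uniq _.
have uE : u = \sum_(e <- D) res_comp e u.
  apply/rowP=> k; rewrite summxE; apply/mpolyP=> m; rewrite raddf_sum /=.
  have [m0|m0] := eqVneq (u 0 k)@_m 0.
    by rewrite big1 // => e _; rewrite mxE mcoeff_hcomp m0 if_same.
  have eD : (mdeg m)%:Z + mgr_shift k \in D.
    rewrite mem_undup inE; apply/orP; right; apply/allpairsPdep.
    exists k, (mdeg m); rewrite mem_enum mem_iota; split=> //.
    by rewrite /= add0n; apply: msize_mdeg_lt; rewrite mcoeff_msupp.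
  rewrite (bigD1_seq _ eD uD) /= mxE mcoeff_hcomp addrK eqxx big1 ?addr0 // => e ne.
  by rewrite mxE mcoeff_hcomp eq_sym subr_eq (negbTE ne).
(* These homogeneous elements of degrees [e] sum to [mgr_aug F u - mgr_aug F u = 0], so directness
   of the grading kills the one in degree [d]. *)
pose y e := mgr_aug F (res_comp e u) - (if e == d then mgr_aug F u else 0).
have : y d = 0.
  apply: (@gm_direct _ _ M D y) => // [e|].
    apply: gm_partB; first exact: gm_part_aug.
    by case: eqP => [->|_] //; exact: gm_part0.
  rewrite sumrB -raddf_sum -uE (bigD1_seq d) //= eqxx.
  by rewrite big1 ?addr0 ?subrr // => e /negbTE->.
by rewrite /y eqxx => /eqP; rewrite subr_eq0 => /eqP.
Qed.

Lemma socle_degree_le (e : 'I_s) d rho (x : M) :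
    (forall k (l : 'I_(mgr_rank F k)), mgr_shift l - k%:Z <= rho) ->
    (forall y : M, 'X_e *: y = 0 -> y = 0) ->
    gm_part d x -> (forall y : M, x <> 'X_e *: y) ->
    (forall j, exists y : M, 'X_j *: x = 'X_e *: y) ->
  d <= rho.
Proof.
move=> shP reg xd xN xX.
apply: (@socle_class_le [set e] d rho shP 0%N); first exact: cards1.
  exact: exact_above_regular.
have [u0 u0x] := mgr_surj F x; rewrite addr0.
have ux : mgr_aug F (res_comp d u0) = x by rewrite aug_res_comp u0x.
exists (res_comp d u0); split=> [|j|[w]].
- exact: res_comp_id.
- have [y xy] := xX j; have [v vy] := mgr_surj F y.
  have [w wE] : exists w, 'X_j *: res_comp d u0 - 'X_e *: v = w *m mgr_diff F 0.
    by apply/mgr_exact0; rewrite linearB /= !linearZ /= ux vy xy scalerN subrr.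
  by exists w; rewrite -wE subKr; apply: var_mod_gen; rewrite inE.
rewrite -[[set e]]setU0 => /var_mod_split[v /var_mod_set0/eqP].
rewrite subr_eq0 => /eqP uv; apply: (xN (mgr_aug F v)).
by rewrite -linearZ -uv raddfB /= aug_diff subr0.
Qed.

End Resolution.

Lemma regularity_ge_socle_degree (K : fieldType) (s : nat) (M : graded_module K s)
    (e : 'I_s) (d rho : int) (x : M) :
    is_regularity M rho ->
    (forall y : M, 'X_e *: y = 0 -> y = 0) ->
    gm_part d x -> (forall y : M, x <> 'X_e *: y) ->
    (forall j, exists y : M, 'X_j *: x = 'X_e *: y) ->
  d <= rho.
Proof.
move=> [F [_ bettiP]]; apply: (socle_degree_le (F := F)) => k l.
apply: bettiP; apply/eqP; rewrite -lt0n; apply/card_gt0P; exists l.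
by rewrite inE.
Qed.

(** * Power sums over a finite field *)

Section PowerSums.
Variable K : finFieldType.

Lemma expf_card_pred (x : K) : x != 0 -> x ^+ #|K|.-1 = 1.
Proof.
move=> x0; apply: (mulfI x0).
by rewrite -exprS prednK ?mulr1 ?finfield.expf_card //; apply/card_gt0P; exists 0.
Qed.

(** Translation by 1 permutes K, so it does not change the sum of all elements. *)
Lemma natr_card : #|K|%:R = 0 :> K.
Proof.
have : \sum_(x : K) x = \sum_(x : K) (x + 1).
  by rewrite [LHS](reindex_inj (addIr 1)).
rewrite big_split /= -[LHS]addr0 => /addrI/esym.
by rewrite sumr_const.
Qed.

(** Some unit [a] has [a ^+ k != 1], as X^k - 1 has at most k roots; scaling by [a] multiplies the
    sum by [a ^+ k] yet only permutes its terms. *)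
Lemma sum_expf_eq0 k : (0 < k < #|K|.-1)%N -> \sum_(x : K) x ^+ k = 0.
Proof.
case/andP=> k0 kq.
have [a a0 ak] : exists2 a : K, a != 0 & a ^+ k != 1.
  have p0 : 'X^k - 1 != 0 :> {poly K} by rewrite -size_poly_eq0 size_XnsubC.
  have := max_poly_roots p0 (rs := enum (predC1 (0 : K))).
  rewrite size_XnsubC // -cardE cardC1 enum_uniq ltnNge kq.
  case: (boolP (all _ _)) => [_ /(_ isT isT) //|/allPn[a]].
  rewrite mem_enum inE => a0; rewrite rootE !hornerE => ak _.
  by exists a => //; rewrite -subr_eq0.
have : \sum_(x : K) x ^+ k = a ^+ k * \sum_(x : K) x ^+ k.
  rewrite [LHS](reindex_inj (mulfI a0)) mulr_sumr.
  by apply: eq_bigr => x _; rewrite exprMn.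
move/eqP; rewrite -subr_eq0 -[X in X - _]mul1r -mulrBl mulf_eq0 subr_eq0 eq_sym.
by rewrite (negbTE ak) => /eqP.
Qed.

Lemma sum_expf_card_pred : \sum_(x : K) x ^+ #|K|.-1 = -1.
Proof.
have q1 := finfield.finNzRing_gt1 K.
rewrite (bigD1 0) //= expr0n gtn_eqF ?ltn_predRL // add0r.
rewrite (eq_bigr (fun=> 1)) => [|x]; last exact: expf_card_pred.
rewrite sumr_const; apply/eqP; rewrite -subr_eq0 opprK -mulrSr.
rewrite (_ : #|_| = #|predC1 (0 : K)|) // cardC1 prednK ?natr_card //.
exact: ltnW.
Qed.

End PowerSums.

(** * The toric ideal and monomials modulo I + (t_e) *)

Lemma meval_dhomogZ (K : fieldType) (s d : nat) (f : {mpoly K[s]}) (c : K) (v : 'I_s -> K) :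
  f \is d.-homog -> f.@[fun i => c * v i] = c ^+ d * f.@[v].
Proof.
move=> /dhomogP hf; rewrite !mevalE mulr_sumr; apply: eq_big_seq => m /hf /= <-.
rewrite mulrCA; congr (_ * _); rewrite mdegE -prodrXr -big_split /=.
by apply: eq_bigr => i _; rewrite exprMn.
Qed.

Section ToricIdeal.
Variables (K : finFieldType) (G : multigraph) (e : 'I_#|edge G|).
Local Notation S := {mpoly K[#|edge G|]}.
Local Notation V := (vertex G).
Local Notation I := (generated_ideal (homog_vanishing (toric_subset K G))).
Local Notation q := #|K|.
Implicit Types (x : V -> K) (f g : S) (m : 'X_{1..#|edge G|}).

Definition toric_eval x f : K := f.@[fun i => toric_point x 0 i].

Lemma toric_point_neq0 x i : (forall v, x v != 0) -> toric_point x 0 i != 0.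
Proof. by move=> x0; rewrite mxE; apply/prodf_neq0. Qed.

Lemma toric_eval_ideal x f : (forall v, x v != 0) -> f \in I -> toric_eval x f = 0.
Proof.
move=> x0 /asboolP[n [a [g [Pg ->]]]].
have tx : toric_point x != 0.
  by apply: contraNneq (toric_point_neq0 e x0) => ->; rewrite mxE.
have dim1 : \dim <[toric_point x]>%VS == 1%N by rewrite dim_vline tx.
rewrite /toric_eval raddf_sum big1 // => k _; rewrite /= mevalM.
have [_ /(_ (exist _ <[toric_point x]>%VS dim1))] := Pg k.
by rewrite /vanishes_at /= => ->; rewrite ?mulr0 ?memv_line //; exists x.
Qed.

Lemma mem_toric_ideal d f : f \is d.-homog ->
  (forall x, (forall v, x v != 0) -> toric_eval x f = 0) -> f \in I.
Proof.
move=> hf fX; apply/asboolP; exists 1%N, (fun=> 1), (fun=> f).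
split=> [_|]; last by rewrite big_ord1 mul1r.
split; first by exists d.
move=> p [x x0 px] y; rewrite px => /vlineP[c ->] _.
rewrite -[RHS](mulr0 (c ^+ d)) -(fX x x0) /toric_eval -(meval_dhomogZ _ _ hf).
by apply: meval_eq => i; rewrite mxE.
Qed.

(** Each homogeneous component of [f] vanishes on the torus points, because ['X_e] takes nonzero
    values there. *)
Lemma toric_ideal_colon f : 'X_e * f \in I -> f \in I.
Proof.
move=> ef; rewrite [f](pihomog_partitionE (leqnn (mmeasure mdeg f))).
apply: rpred_sum => d _; apply: (mem_toric_ideal (pihomogP _ d f)) => x x0.
have hX : homog_deg 1 ('X_e : S) by rewrite /= dhomogX /= mdeg1.
have := pihomog_generated (@homog_vanishing_homog _ _ _) (d + 1) ef.
have := hcompM d%:Z f hX; rewrite /= mulrC => -> /(toric_eval_ideal x0).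
rewrite /toric_eval mulrC mevalM mevalXU => /eqP; rewrite mulf_eq0.
by rewrite (negbTE (toric_point_neq0 e x0)) => /eqP.
Qed.

Definition mod_toric f : Prop := exists g, f - 'X_e * g \in I.

Lemma mod_toricM f g : mod_toric f -> mod_toric (f * g).
Proof.
move=> [h fh]; exists (h * g); rewrite mulrA -mulrBl mulrC.
exact: generated_idealM.
Qed.

(** Both ['X_j ^+ q.-1] and ['X_e ^+ q.-1] take the value 1 at every torus point. *)
Lemma mod_toric_pow (j : 'I_#|edge G|) : mod_toric ('X_j ^+ q.-1).
Proof.
have q1 : (0 < q.-1)%N by rewrite ltn_predRL finfield.finNzRing_gt1.
exists ('X_e ^+ q.-2); rewrite -exprS prednK //.
apply: (@mem_toric_ideal q.-1) => [|x x0].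
  have hX i : ('X_i ^+ q.-1 : S) \is q.-1.-homog.
    by rewrite mpolyXn dhomogX /= mdegMn mdeg1 mul1n.
  exact: rpredB.
rewrite /toric_eval mevalB !rmorphXn /= !mevalXU.
by rewrite !expf_card_pred ?subrr ?toric_point_neq0.
Qed.

Lemma mod_toric_large m : (#|edge G| * q < mdeg m)%N -> mod_toric 'X_[m].
Proof.
move=> ltm; have [j jm] : exists j, (q.-1 <= m j)%N.
  apply/existsP; apply: contraTT ltm; rewrite negb_exists -leqNgt mdegE => /forallP mj.
  rewrite -[X in (X * _)%N]card_ord -sum_nat_const; apply: leq_sum => j _.
  by have := mj j; lia.
have -> : 'X_[m] = 'X_j ^+ q.-1 * 'X_[m - U_(j) *+ q.-1] :> S.
  rewrite mpolyXn -mpolyXD addmC submK //; apply/mnm_lepP => i.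
  by rewrite mulmnE mnm1E; case: eqP => [<-|]; rewrite ?mul1n.
exact/mod_toricM/mod_toric_pow.
Qed.

(** Multiply by variables as long as the product stays outside I + (t_e); the degree bound of
    [mod_toric_large] stops the process. *)
Lemma max_monomial m : ~ mod_toric 'X_[m] -> exists m' : 'X_{1..#|edge G|},
  [/\ (mdeg m <= mdeg m')%N, ~ mod_toric 'X_[m']
    & forall j, mod_toric ('X_j * 'X_[m'])].
Proof.
move En: (#|edge G| * q - mdeg m)%N => n.
elim: n m En => [|n IHn] m En mN.
  exists m; split=> // j; rewrite -mpolyXD; apply: mod_toric_large.
  by rewrite mdegD mdeg1; lia.
have [mX|] := pselect (forall j, mod_toric ('X_j * 'X_[m])); first by exists m.
move=> /existsNP[j]; rewrite -mpolyXD => jN.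
have [|m' [mm' m'N m'X]] := IHn _ _ jN; first by rewrite mdegD mdeg1; lia.
by exists m'; split=> //; apply: leq_trans mm'; rewrite mdegD leq_addl.
Qed.

Lemma toric_regularity_ge m (rho : int) :
  is_regularity (coordinate_ring (toric_subset K G)) rho ->
  ~ mod_toric 'X_[m] -> (mdeg m)%:Z <= rho.
Proof.
move=> hrho /max_monomial[m' [mm' m'N m'X]].
apply: (@le_trans _ _ (mdeg m')%:Z) => //.
pose pr := quot_proj (homog_vanishing (toric_subset K G)).
apply: (@regularity_ge_socle_degree _ _ (coordinate_ring (toric_subset K G))
  e _ _ (pr 'X_[m']) hrho).
- move=> y; rewrite -[y]quot_projK -quot_projZ -[0](raddf0 pr) => /quot_projP.
  by rewrite subr0 => /toric_ideal_colon yI; apply/quot_projP; rewrite subr0.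
- by exists 'X_[m'] => //=; rewrite dhomogX.
- move=> y; rewrite -[y]quot_projK -quot_projZ => /quot_projP yI.
  by apply: m'N; exists (repr y).
move=> j; have [g gI] := m'X j; exists (pr g).
by rewrite -!quot_projZ; apply/quot_projP.
Qed.

(** The exponent of [x v] once each edge variable is replaced by the product of its end values. *)
Definition vertex_deg (v : V) m : nat := \sum_i (v \in ends (enum_val i)) * m i.

Lemma toric_evalX x m : toric_eval x 'X_[m] = \prod_v x v ^+ vertex_deg v m.
Proof.
rewrite /toric_eval mevalX; under [RHS]eq_bigr do rewrite -prodrXr.
rewrite exchange_big; apply: eq_bigr => i _ /=; rewrite mxE big_mkcond /= -prodrXl.
by apply: eq_bigr => v _; case: (v \in _); rewrite ?mul1n ?mul0n ?expr1n.
Qed.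

(** * A linear functional vanishing on I(X) *)

Variable A : {set V}.

(* The weight cuts toric_sum f down to the x with x v <> 0 for v \in A and     *)
(* x v = 1 for v \notin A, hence to points of the torus.                      *)
Definition toric_weight (v : V) (y : K) : K := if v \in A then y else (y == 1)%:R.

Definition toric_sum f : K :=
  \sum_(x : {ffun V -> K}) (\prod_v toric_weight v (x v)) * toric_eval x f.

Lemma toric_sumD f g : toric_sum (f + g) = toric_sum f + toric_sum g.
Proof.
by rewrite -big_split; apply: eq_bigr => x _; rewrite /toric_eval mevalD mulrDr.
Qed.

Lemma toric_sumZ c f : toric_sum (c *: f) = c * toric_sum f.
Proof.
by rewrite mulr_sumr; apply: eq_bigr => x _; rewrite /toric_eval mevalZ mulrCA.
Qed.

Lemma toric_sum_ideal f : f \in I -> toric_sum f = 0.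
Proof.
move=> fI; apply: big1 => x _.
have [/forallP x0|] := boolP [forall v, x v != 0].
  by rewrite toric_eval_ideal ?mulr0.
rewrite negb_forall => /existsP[v]; rewrite negbK => /eqP xv.
by rewrite (bigD1 v) //= /toric_weight xv [0 == 1]eq_sym oner_eq0 if_same !mul0r.
Qed.

(** Weight and monomial are both products over the vertices, so the sum factors; the extra 1 in the
    exponent comes from the weight. *)
Lemma toric_sumX m :
  toric_sum 'X_[m] = \prod_(v in A) \sum_(y : K) y ^+ (vertex_deg v m).+1.
Proof.
transitivity (\prod_v \sum_(y : K) toric_weight v y * y ^+ vertex_deg v m).
  rewrite bigA_distr_bigA; apply: eq_bigr => x _.
  by rewrite toric_evalX -big_split.
rewrite [RHS]big_mkcond; apply: eq_bigr => v _; rewrite /toric_weight.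
case: ifP => _; first by apply: eq_bigr => y _; rewrite exprS.
rewrite (bigD1 1) //= eqxx mul1r expr1n big1 ?addr0 // => y /negbTE ->.
by rewrite mul0r.
Qed.

Lemma toric_sum_eq0 f :
  (forall m, f@_m != 0 -> exists2 v, v \in A & ((vertex_deg v m).+1 < q.-1)%N) ->
  toric_sum f = 0.
Proof.
move=> hf; rewrite [f]mpolyE.
apply: (big_rec (fun g => toric_sum g = 0)) => [|m g _ g0].
  by rewrite -[0](scale0r 0) toric_sumZ mul0r.
rewrite toric_sumD g0 addr0 toric_sumZ; have [->|/hf[v vA vm]] := eqVneq f@_m 0.
  by rewrite mul0r.
by rewrite toric_sumX (bigD1 v) //= sum_expf_eq0 // mul0r mulr0.
Qed.

Lemma not_mod_toric m :
    (forall v, v \in A -> (vertex_deg v m).+1 = q.-1) ->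
    (forall m' : 'X_{1..#|edge G|}, mdeg m' = mdeg m -> (0 < m' e)%N ->
      exists2 v, v \in A & ((vertex_deg v m').+1 < q.-1)%N) ->
  ~ mod_toric 'X_[m].
Proof.
move=> mA mP [g gI].
have sX : toric_sum 'X_[m] != 0.
  rewrite toric_sumX; apply/prodf_neq0 => v vA.
  by rewrite mA // sum_expf_card_pred oppr_eq0 oner_eq0.
(* Only the component of degree [mdeg m] matters; in it, every monomial coming from ['X_e * g]
   contains t_e. *)
have := pihomog_generated (@homog_vanishing_homog _ _ _) (mdeg m) gI.
rewrite raddfB /= pihomogX eqxx => /toric_sum_ideal.
rewrite -scaleN1r toric_sumD toric_sumZ [X in _ * X]toric_sum_eq0.
  by rewrite mulr0 addr0 => s0; rewrite s0 eqxx in sX.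
move=> m'; rewrite -[pihomog _ _ _]/(hcomp (mdeg m) _) mcoeff_hcomp.
case: ifP => [/eqP[mm']|_]; last by rewrite eqxx.
move=> ne0; apply: mP => //; rewrite lt0n; apply: contraNneq ne0 => m'e.
have /(_ m') -> // := @var_ideal_gen _ _ [set e] g e (set11 e).
by move=> j /set1P ->.
Qed.

End ToricIdeal.

(** * Degree counts at an independent set *)

Section Independent.
Variables (G : multigraph) (A : {set vertex G}) (hA : independent A).

Lemma independent_edge (c : edge G) v w :
  v \in A -> w \in A -> v \in ends c -> w \in ends c -> v = w.
Proof.
move=> vA wA vc wc; apply/eqP/negPn/negP => vw; apply: (hA vA wA (e := c)).
apply/esym/eqP; rewrite eqEcard card_ends cards2 vw leqnn andbT.
by apply/subsetP => u /set2P[]->.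
Qed.

Lemma independent_card (c : edge G) : (\sum_(v in A) (v \in ends c) <= 1)%N.
Proof.
have -> : (\sum_(v in A) (v \in ends c) = #|[set v in A | v \in ends c]|)%N.
  by rewrite -sum1dep_card big_mkcondr; apply: eq_bigr => v _; case: ifP.
apply/card_le1_eqP => v w; rewrite !inE => /andP[vA vc] /andP[wA wc].
exact: (independent_edge wA vA wc vc).
Qed.

(** Double counting: each edge contributes its exponent to at most one vertex of [A], and [e] to
    none, so the degrees over [A] sum to less than [mdeg m]. *)
Lemma vertex_deg_lt (e : 'I_#|edge G|) k (m : 'X_{1..#|edge G|}) :
  [disjoint ends (enum_val e) & A] -> mdeg m = (#|A| * k)%N -> (0 < m e)%N ->
  exists2 v, v \in A & (vertex_deg v m < k)%N.
Proof.
move=> eA mk me; apply/exists_inP; apply: contraTT me; rewrite negb_exists_in => /forall_inP mA.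
have : (#|A| * k <= \sum_(v in A) vertex_deg v m)%N.
  by rewrite -sum_nat_const; apply: leq_sum => v /mA; rewrite -leqNgt.
rewrite -mk mdegE exchange_big /= -leqNgt => le_sum.
have le_m i : (\sum_(v in A) (v \in ends (enum_val i)) * m i <= m i)%N.
  by rewrite -big_distrl /= -[X in (_ <= X)%N]mul1n leq_mul2r independent_card orbT.
have e_0 : (\sum_(v in A) (v \in ends (enum_val e)) * m e = 0)%N.
  by apply: big1 => v vA; rewrite (disjointFl eA vA).
move: le_sum; rewrite (bigD1 e) //= [X in (_ <= X)%N](bigD1 e) //= e_0 add0n => le_sum.
rewrite -(leq_add2r (\sum_(i | i != e) m i)) add0n; apply: (leq_trans le_sum).
by apply: leq_sum => i _; exact: le_m.
Qed.

End Independent.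

Theorem proposition2p7 (K : finFieldType) (q : nat) (hq : #|K| = q)
    (G : multigraph) (hG : no_isolated_vertices G)
    (r : nat) (A : {set vertex G}) (hr : #|A| = r) (hA : independent A)
    (hE : exists e : edge (delete_vertices A), True)
    (rho : int)
    (hrho : is_regularity (coordinate_ring (toric_subset K G)) rho) :
  r%:Z * (q%:Z - 2) <= rho.
Proof.
have [[e0 e0A] _] := hE; pose e := enum_rank e0.
have [c hc] := choice hG.
pose m : 'X_{1..#|edge G|} := (\sum_(v in A) U_(enum_rank (c v)) *+ (q - 2))%MM.
have mdegm : mdeg m = (r * (q - 2))%N.
  rewrite mdeg_sum -hr -sum_nat_const; apply: eq_bigr => v _.
  by rewrite mdegMn mdeg1 mul1n.
have q2 : (1 < q)%N by rewrite -hq finfield.finNzRing_gt1.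
(* Truncated subtraction agrees with the integer one because [q] is at least 2. *)
have -> : r%:Z * (q%:Z - 2) = (mdeg m)%:Z by rewrite mdegm PoszM -subzn.
have degm v : v \in A -> vertex_deg v m = (q - 2)%N.
  move=> vA; transitivity (\sum_i \sum_(w in A)
      (v \in ends (enum_val i)) * ((enum_rank (c w) == i) * (q - 2)))%N.
    apply: eq_bigr => i _; rewrite mnm_sumE big_distrr /=.
    by apply: eq_bigr => w _; rewrite mulmnE mnm1E.
  rewrite exchange_big /= (bigD1 v) //= (bigD1 (enum_rank (c v))) //=.
  rewrite enum_rankK hc eqxx !mul1n big1 => [|i]; last first.
    by rewrite eq_sym => /negbTE->; rewrite muln0.
  (* For [w] in [A] other than [v], the edge [c w] misses [v] by independence. *)
  rewrite big1 ?addn0 // => w /andP[wA wv]; apply: big1 => i _.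
  case: eqP => [<-|_]; last by rewrite mul0n muln0.
  rewrite enum_rankK; case: (boolP (v \in _)) => // vw.
  by rewrite (independent_edge hA wA vA (hc w) vw) eqxx in wv.
apply: (toric_regularity_ge (e := e) hrho).
apply: (@not_mod_toric _ _ _ A) => [v vA|m' m'm m'e].
  by rewrite degm // hq; lia.
have [||v vA vm] := @vertex_deg_lt G A hA e (q - 2) m' _ _ m'e.
- by rewrite enum_rankK.
- by rewrite m'm mdegm hr.
by exists v => //; rewrite hq; lia.
Qed.
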